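(* Let $n,t,k$ be positive integers with $2\leq k\leq n-2$, $1\leq t\leq\frac{n-k}{2}$ and $n\equiv k\pmod 2$, and let $\alpha\in[0,\frac12]$. Define $$\begin{aligned}\Delta_1(n,t,k,\alpha)&=\Big(k+t-1-\tfrac{\alpha}{2}(n+k)+\alpha\Big)\sqrt{(n-k-2+2\alpha n)^2+4(n^2-k^2)-4\alpha(3n+k-2)(n-k)}\\&\quad+\big[12t^2+(10k-2n-12)t+2n-kn-n^2\big]\alpha^2\\&\quad+\Big[(24-18k)t-20t^2-\tfrac{k^2}{2}+2k+\tfrac{5}{2}n^2-2n-2\Big]\alpha+k^2-n^2+(k+t-1)(n+8t-k-2),\end{aligned}$$ $$\begin{aligned}\Delta_2(n,t,k,\alpha)&=(\alpha-1)n^2+\big[4t\alpha^2+(2-14t-2k)\alpha+4k+12t-4\big]n-4t^2\alpha^2\\&\quad+(k^2+6kt-2k+16t^2-4t)\alpha-3k^2-12kt+4k-16t^2+8t.\end{aligned}$$ Let $G$ be a $t$-connected graph on $n$ vertices with matching number $\mu(G)\leq\frac{n-k}{2}$. Then: (i) If $\Delta_1(n,t,k,\alpha)<0$, then $\rho_{\alpha}(G)\leq\rho_{\alpha}\big(K_t\vee(K_{n+1-2t-k}\cup\overline{K_{t+k-1}})\big)$, with equality if and only if $G\cong K_t\vee(K_{n+1-2t-k}\cup\overline{K_{t+k-1}})$. (ii) If $\Delta_1(n,t,k,\alpha)=0$ and $\Delta_2(n,t,k,\alpha)\geq0$, then $\rho_{\alpha}(G)\leq\rho_{\alpha}\big(K_t\vee(K_{n+1-2t-k}\cup\overline{K_{t+k-1}})\big)=\rho_{\alpha}\big(K_{\frac{n-k}{2}}\vee\overline{K_{\frac{n+k}{2}}}\big)$,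 with equality if and only if $G\cong K_t\vee(K_{n+1-2t-k}\cup\overline{K_{t+k-1}})$ or $G\cong K_{\frac{n-k}{2}}\vee\overline{K_{\frac{n+k}{2}}}$. (iii) If $\Delta_1(n,t,k,\alpha)>0$ and $\Delta_2(n,t,k,\alpha)\geq0$, then $\rho_{\alpha}(G)\leq\rho_{\alpha}\big(K_{\frac{n-k}{2}}\vee\overline{K_{\frac{n+k}{2}}}\big)$, with equality if and only if $G\cong K_{\frac{n-k}{2}}\vee\overline{K_{\frac{n+k}{2}}}$.
   Context: All graphs are finite, simple and connected. For a graph $G$ with adjacency matrix $A(G)$ and diagonal degree matrix $D(G)$, and $\alpha\in[0,1]$, $A_{\alpha}(G)=\alpha D(G)+(1-\alpha)A(G)$ and $\rho_{\alpha}(G)$ is the largest eigenvalue of $A_{\alpha}(G)$. The matching number $\mu(G)$ is the maximum number of pairwise disjoint edges of $G$. The connectivity of $G$ is the minimum number of vertices whose deletion yields a disconnected graph or a single vertex; $G$ is $t$-connected if its connectivity is at least $t$. $K_m$ is the complete graph on $m$ vertices, $\overline{K_m}$ the edgeless graph on $m$ vertices, $\cup$ denotes disjoint union and $G_1\vee G_2$ the join (disjoint union plus all edges between $V(G_1)$ and $V(G_2)$). *)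

(* Defs.v *)
From HB Require Import structures.
From mathcomp Require Import all_boot all_order all_algebra all_fingroup.
From mathcomp Require Import classical_sets reals.
Set Implicit Arguments. Unset Strict Implicit. Unset Printing Implicit Defensive.
Import Order.TTheory GRing.Theory Num.Theory.

Definition simple_graph (n : nat) (g : rel 'I_n) : Prop :=
  symmetric g /\ irreflexive g.

Definition deg (n : nat) (g : rel 'I_n) (i : 'I_n) : nat := #|[set j | g i j]|.

Definition del_connected (n : nat) (g : rel 'I_n) (S : {set 'I_n}) : bool :=
  [forall x in ~: S, forall y in ~: S,
     connect [rel u v | [&& g u v, u \notin S & v \notin S]] x y].

Definition is_cut (n : nat) (g : rel 'I_n) (S : {set 'I_n}) : bool :=
  (#|~: S| == 1) || ~~ del_connected g S.

Definition connectivity (n : nat) (g : rel 'I_n) : nat :=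
  \big[minn/n]_(S : {set 'I_n} | is_cut g S) #|S|.

Definition t_connected (n : nat) (g : rel 'I_n) (t : nat) : bool :=
  t <= connectivity g.

Definition is_matching (n : nat) (g : rel 'I_n) (M : {set {set 'I_n}}) : bool :=
  [forall e in M, exists u, exists v, (g u v) && (e == [set u; v])] && finset.trivIset M.

Definition matching_number (n : nat) (g : rel 'I_n) : nat :=
  \max_(M : {set {set 'I_n}} | is_matching g M) #|M|.

Definition graph_iso (n : nat) (g h : rel 'I_n) : Prop :=
  exists s : 'S_n, forall x y, g x y = h (s x) (s y).

Local Open Scope ring_scope.

Definition A_alpha (R : realType) (n : nat) (g : rel 'I_n) (alpha : R) : 'M[R]_n :=
  \matrix_(i, j) (alpha * (i == j)%:R * (deg g i)%:R + (1 - alpha) * (g i j)%:R).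

(* rho_alpha(G): largest eigenvalue of A_alpha(G) (symmetric, so all eigenvalues real) *)
Definition rho_alpha (R : realType) (n : nat) (g : rel 'I_n) (alpha : R) : R :=
  sup [set a : R | eigenvalue (A_alpha g alpha) a].

(* K_t \/ (K_{n+1-2t-k} u co-K_{t+k-1}) on 'I_n:
   vertices < t form K_t, vertices in [t, n+1-t-k) form K_{n+1-2t-k},
   vertices >= n+1-t-k form the independent set of size t+k-1. *)
Definition graph_H1 (n t k : nat) : rel 'I_n :=
  fun x y => (x != y) &&
    [|| (x < t)%N, (y < t)%N | (x < n + 1 - t - k)%N && (y < n + 1 - t - k)%N].

(* K_{(n-k)/2} \/ co-K_{(n+k)/2}: vertices < (n-k)/2 form the clique. *)
Definition graph_H2 (n k : nat) : rel 'I_n :=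
  fun x y => (x != y) && (((x < (n - k)./2)%N) || ((y < (n - k)./2)%N)).

Definition Delta1 (R : realType) (n t k : nat) (a : R) : R :=
  let n := n%:R in let t := t%:R in let k := k%:R in
  (k + t - 1 - a / 2 * (n + k) + a) *
    Num.sqrt ((n - k - 2 + 2 * a * n) ^+ 2 + 4 * (n ^+ 2 - k ^+ 2)
              - 4 * a * (3 * n + k - 2) * (n - k))
  + (12 * t ^+ 2 + (10 * k - 2 * n - 12) * t + 2 * n - k * n - n ^+ 2) * a ^+ 2
  + ((24 - 18 * k) * t - 20 * t ^+ 2 - k ^+ 2 / 2 + 2 * k + 5 / 2 * n ^+ 2 - 2 * n - 2) * a
  + k ^+ 2 - n ^+ 2 + (k + t - 1) * (n + 8 * t - k - 2).

Definition Delta2 (R : realType) (n t k : nat) (a : R) : R :=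
  let n := n%:R in let t := t%:R in let k := k%:R in
  (a - 1) * n ^+ 2 + (4 * t * a ^+ 2 + (2 - 14 * t - 2 * k) * a + 4 * k + 12 * t - 4) * n
  - 4 * t ^+ 2 * a ^+ 2
  + (k ^+ 2 + 6 * k * t - 2 * k + 16 * t ^+ 2 - 4 * t) * a
  - 3 * k ^+ 2 - 12 * k * t + 4 * k - 16 * t ^+ 2 + 8 * t.

Arguments graph_H1 n t k : clear implicits.
Arguments graph_H2 n k : clear implicits.

(* Main.v *)
(* By Tutte-Berge there is a vertex set S such that g - S has at least |S| + k
   components, and t <= |S| <= h = (n-k)/2 by connectivity.  Put weight 1 on S and
   (1-a)|S| / (X - c), with X = x - a|S| + 1, on a vertex of a component of size c.
   Convexity of c / (X - c) shows that this positive vector is a supersolution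
   A v <= x v as soon as the cubic f_s attached to K_s v (K_(2(h-s)+1) u co-K_(s+k-1)),
   s = |S|, is nonnegative at x; so rho(g) <= x, with equality only for that graph
   and f_s(x) = 0.  It remains to choose x with f_s(x) >= 0 for all t <= s <= h.
   Write f_s = f_h + (h-s) Q_s, where Q_s increases with s, and let theta be the
   spectral radius for s = h.  Then Delta1 = 4 Q_t(theta): if it is nonnegative,
   x = theta works; otherwise the root of f_t beyond theta does. *)

Require Import Defs.
From HB Require Import structures.
From mathcomp Require Import all_boot all_order all_algebra all_fingroup.
From mathcomp Require Import polyrcf.
From mathcomp Require Import boolp classical_sets reals.
From mathcomp Require Import zify ring lra.
Import Order.TTheory GRing.Theory Num.Theory.
Set Implicit Arguments. Unset Strict Implicit. Unset Printing Implicit Defensive.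
Local Open Scope ring_scope.

(** * Matchings as involutions, Gallai's lemma and the Tutte-Berge bound *)

Section Pairing.

Variable T : finType.
Implicit Types (g : rel T) (m : T -> T).

(** A matching is encoded as an involution that swaps matched partners; its fixed points are the
    missed vertices. *)
Definition pairing g m : Prop :=
  involutive m /\ forall x, m x != x -> g x (m x).

Definition covered m : {set T} := [set x | m x != x].

Definition pairs m : {set {set T}} := [set [set x; m x] | x in covered m].

Lemma mem_pairs_eq m x y : involutive m ->
  x \in [set y; m y] -> [set x; m x] = [set y; m y].
Proof.
move=> mK; rewrite !inE => /orP[] /eqP-> //.
by rewrite mK finset.setUC.
Qed.

Lemma trivIset_pairs m : involutive m -> finset.trivIset (pairs m).
Proof.
move=> mK; apply/finset.trivIsetP => _ _ /imsetP[x _ ->] /imsetP[y _ ->] nxy.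
rewrite -setI_eq0; apply/eqP/setP => z; rewrite [RHS]inE; apply/negP.
case/setIP => /(mem_pairs_eq mK) ex /(mem_pairs_eq mK) ey.
by rewrite -ex ey eqxx in nxy.
Qed.

Lemma card_covered m : involutive m -> #|covered m| = (#|pairs m| * 2)%N.
Proof.
move=> mK; have part : finset.partition (pairs m) (covered m).
  apply/and3P; split; last 1 first.
  - by apply/imsetP => -[x _ /setP /(_ x)]; rewrite !inE eqxx.
  - apply/eqP/setP => z; apply/bigcupP/idP.
      move=> [_ /imsetP[x +  ->]].
      by rewrite !inE => xc /orP[] /eqP-> //; rewrite mK eq_sym.
    by move=> zc; exists [set z; m z]; [exact: imset_f|rewrite !inE eqxx].
  - exact: trivIset_pairs.
apply: card_uniform_partition part => _ /imsetP[x xc ->].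
by rewrite cards2 eq_sym; move: xc; rewrite inE => ->.
Qed.

Lemma pairing_id g : pairing g id.
Proof. by split => // x; rewrite eqxx. Qed.

(* The pairing obtained from m by adding the edge xy, where x is missed by m;
   the partner of y (if any) becomes missed. *)
Definition rematch m (x y : T) (z : T) : T :=
  if z == x then y else if z == y then x else if z == m y then z else m z.

Lemma rematch_pairing g m x y : symmetric g -> pairing g m ->
  g x y -> x != y -> m x = x -> pairing g (rematch m x y).
Proof.
move=> gs [mK mg] gxy xy mx; have myx : m y != x.
  by apply: contra xy => /eqP e; rewrite -(mK y) e mx.
split=> [z|z]; rewrite /rematch.
- case: (eqVneq z x) => [->|zx]; first by rewrite eqxx [y == x]eq_sym (negPf xy).
  case: (eqVneq z y) => [->|zy]; first by rewrite eqxx.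
  case: (eqVneq z (m y)) => [e|zmy].
    by rewrite (negPf zx) (negPf zy) e eqxx.
  have -> : (m z == x) = false.
    by apply/negbTE; apply: contra zx => /eqP e; rewrite -(mK z) e mx.
  have -> : (m z == y) = false.
    by apply/negbTE; apply: contra zmy => /eqP <-; rewrite mK.
  by rewrite (inj_eq (can_inj mK)) (negPf zy) mK.
- case: (eqVneq z x) => [->//|zx].
  case: (eqVneq z y) => [->|zy]; first by rewrite gs.
  case: (eqVneq z (m y)) => [e|zmy]; first by rewrite eqxx.
  exact: mg.
Qed.

Lemma covered_rematch m x y : involutive m -> x != y -> m x = x -> m y != y ->
  covered (rematch m x y) = x |: (covered m :\ m y).
Proof.
move=> mK xy mx my; apply/setP => z; rewrite !inE /rematch.
case: (eqVneq z x) => [->|zx] /=; first by rewrite eq_sym xy.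
case: (eqVneq z y) => [->|zy] /=; first by rewrite xy eq_sym my.
by case: (eqVneq z (m y)) => [e|zmy] /=; rewrite ?eqxx.
Qed.

Lemma covered_rematch_free m x y : involutive m -> x != y -> m x = x -> m y = y ->
  covered (rematch m x y) = x |: (y |: covered m).
Proof.
move=> mK xy mx my; apply/setP => z; rewrite !inE /rematch my.
case: (eqVneq z x) => [->|zx] /=; first by rewrite eq_sym xy.
by case: (eqVneq z y) => [->|zy] /=.
Qed.

(** Adding an edge between two missed vertices would cover two more vertices. *)
Lemma max_pairing_free g m N x y : symmetric g -> irreflexive g ->
  (forall m', pairing g m' -> (#|covered m'| <= N)%N) ->
  pairing g m -> #|covered m| = N -> m x = x -> m y = y -> ~~ g x y.
Proof.
move=> gs gi ub mp mN mx my; apply/negP => gxy.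
have xy : x != y by apply: contraTneq gxy => ->; rewrite gi.
have := ub _ (rematch_pairing gs mp gxy xy mx).
rewrite (covered_rematch_free mp.1) // !cardsU1 !inE mx my !eqxx mN.
by rewrite (negPf xy) !add1n ltnNge leqnSn.
Qed.

(* Gallai's lemma.  Among the maximum pairings missing w, one agreeing with m
   in as many vertices as possible would still miss u or z. *)
Lemma gallai g N m m' u w z : symmetric g -> irreflexive g ->
  (forall m', pairing g m' -> (#|covered m'| <= N)%N) ->
  pairing g m -> #|covered m| = N -> m u = u -> m z = z -> u != z ->
  m w != w -> pairing g m' -> #|covered m'| = N -> m' w = w ->
  exists m0, [/\ pairing g m0, #|covered m0| = N, m0 w = w & m0 u = u \/ m0 z = z].
Proof.
move=> gs gi ub mp mN mu mz uz mw.
have [d] := ubnP (#|T| - #|[set x | m x == m' x]|).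
elim: d m' => // d IH m' hd mp' mN' mw'.
have [e|m'u] := eqVneq (m' u) u; first by exists m'; split=> //; left.
have [e|m'z] := eqVneq (m' z) z; first by exists m'; split=> //; right.
(* The covered sets have equal size and only [m'] covers [u] and [z], so at least two vertices are
   covered by [m] alone, one of them different from [w]. *)
have [x [xw mx m'x]] : exists x, [/\ x != w, m x != x & m' x == x].
  have c2 : (1 < #|covered m' :\: covered m|)%N.
    have : [set u; z] \subset covered m' :\: covered m.
      by apply/fintype.subsetP => y; rewrite !inE => /orP[] /eqP->; rewrite ?mu ?mz eqxx.
    by move/subset_leq_card; rewrite cards2 uz.
  have c1 : (1 < #|covered m :\: covered m'|)%N.
    rewrite cardsD finset.setIC; move: c2; rewrite cardsD.
    by rewrite mN mN'.
  have /card_gt0P[x] : (0 < #|(covered m :\: covered m') :\ w|)%N.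
    by move: c1; rewrite (cardsD1 w) !inE mw mw' eqxx.
  by rewrite !inE negbK => /and3P[xw m'x mx]; exists x.
have [mK mg] := mp; have [mK' mg'] := mp'.
set y := m x; have gxy : g x y by exact: mg.
have xy : x != y by rewrite eq_sym.
have m'y : m' y != y.
  apply/negP => /eqP e.
  by have := max_pairing_free gs gi ub mp' mN' (eqP m'x) e; rewrite gxy.
have yw : y != w by apply: contraNneq m'y => ->; rewrite mw'.
have rp := rematch_pairing gs mp' gxy xy (eqP m'x).
apply: (IH (rematch m' x y)) rp _ _.
(* Agreement is gained at [x]. The freed vertex [m' y] was no point of agreement: otherwise [m]
   would send it to [y = m x], making it equal to [x], which [m'] fixes. *)
- have sub : [set x0 | m x0 == m' x0] \proper [set x0 | m x0 == rematch m' x y x0].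
    apply/properP; split; last first.
      exists x; rewrite !inE; first by rewrite /rematch eqxx /y.
      by rewrite (eqP m'x).
    apply/fintype.subsetP => v; rewrite !inE /rematch => /eqP e.
    case: (eqVneq v x) => [->|vx]; first by rewrite eqxx.
    case: (eqVneq v y) => [->|vy]; first by rewrite mK eqxx.
    case: (eqVneq v (m' y)) => [vm|vm]; last by rewrite e eqxx.
    case/negP: vx; apply/eqP/(can_inj mK).
    by rewrite -/y e vm mK'.
  have c1 := proper_card sub.
  have c2 : (#|[set x0 | m x0 == rematch m' x y x0]| <= #|T|)%N by exact: max_card.
  by lia.
- rewrite covered_rematch // ?(eqP m'x) // cardsU1 !inE (eqP m'x) eqxx andbF /=.
  have := cardsD1 (m' y) (covered m'); rewrite !inE mK' eq_sym m'y mN' => ->.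
  by [].
- rewrite /rematch ![w == _]eq_sym (negPf xw) (negPf yw).
  by case: (eqVneq (m' y) w).
Qed.

(* The hard half of the Tutte-Berge formula.  The classes of f outside S are
   unions of components of g - S, so there may be fewer of them than components. *)
Lemma tutte_berge g N : symmetric g -> irreflexive g ->
  (forall m, pairing g m -> (#|covered m| <= N * 2)%N) ->
  exists (S : {set T}) (f : T -> {set T}),
    (forall x y, x \notin S -> y \notin S -> g x y -> f x = f y) /\
    (#|S| + #|T| <= #|f @: ~: S| + N * 2)%N.
Proof.
elim: N g => [|N IH] g gs gi ub; last first.
  have [[m [mp mN]]|none] := EM (exists m, pairing g m /\ #|covered m| = (N.+1 * 2)%N); last first.
    have [|S [f [H1 H2]]] := IH g gs gi; last by exists S, f; split=> //; lia.
    move=> m mp; have := ub m mp; rewrite (card_covered mp.1) !leq_pmul2r //.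
    rewrite leq_eqVlt => /orP[/eqP e|//]; case: none; exists m.
    by rewrite card_covered ?e; last exact: mp.1.
  have [[v ess]|noess] := EM (exists v, forall m, pairing g m ->
       #|covered m| = (N.+1 * 2)%N -> m v != v).
    (* Isolating a vertex [v] covered by every maximum pairing lowers the maximum. Putting [v] into
       [S] raises [#|S|] by at most one and loses at most one colour, which matches the two vertices
       by which the bound grows. *)
    pose g' := [rel x y | [&& g x y, x != v & y != v]].
    have [||m' mp'|S [f [H1 H2]]] := IH g'.
    - by move=> x y /=; rewrite gs [(x != v) && _]andbC.
    - by move=> x; rewrite /= gi.
    - have mp2 : pairing g m' by split=> [|x /mp'.2 /and3P[]//]; exact: mp'.1.
      have := ub _ mp2; rewrite leq_eqVlt => /orP[/eqP e|].
        by have := ess _ mp2 e => /mp'.2 /=; rewrite eqxx andbF.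
      by rewrite (card_covered mp2.1) ltn_pmul2r // leq_pmul2r.
    exists (v |: S), f; split.
      move=> x y; rewrite !inE !negb_or => /andP[xv xS] /andP[yv yS] gxy.
      by apply: H1; rewrite //= gxy xv yv.
    have c1 : (#|v |: S| <= #|S|.+1)%N by rewrite cardsU1; case: (_ \notin _).
    have c2 : (#|f @: ~: S| <= #|f @: ~: (v |: S)|.+1)%N.
      apply: leq_trans (_ : #|f v |: f @: ~: (v |: S)| <= _)%N; last first.
        by rewrite cardsU1; case: (_ \notin _).
      apply/subset_leq_card/fintype.subsetP => _ /imsetP[x xS ->].
      rewrite inE; case: (eqVneq x v) => [->|xv]; first by rewrite inE eqxx.
      by apply/orP; right; apply: imset_f; move: xS; rewrite !inE (negPf xv).
    lia.
  pose mx m := pairing g m /\ #|covered m| = (N.+1 * 2)%N.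
  (* Distinct vertices are related when no maximum pairing misses both. As every vertex is missed by
     some maximum pairing, [gallai] gives transitivity, and the classes serve as colours with [S]
     empty. *)
  pose r x y := x = y \/ forall m, mx m -> m x = x -> m y = y -> False.
  have rs x y : r x y -> r y x.
    by case=> [->|h]; [left|right => m0 h1 h2 h3; exact: (h m0)].
  have rt x y z : r x y -> r y z -> r x z.
    case=> [->//|hxy] [<-|hyz]; first by right.
    have [->|xz] := eqVneq x z; [by left|right => m0 [p0 N0] x0 z0].
    have [m' [p' [N' w']]] : exists m', pairing g m' /\ #|covered m'| = (N.+1 * 2)%N /\ m' y = y.
      apply: contrapT => h; apply: noess; exists y => m' p' N'.
      by apply/negP => /eqP e; apply: h; exists m'.
    have [y0|y0] := eqVneq (m0 y) y; first exact: (hxy m0).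
    have [m1 [p1 N1 y1 [x1|z1]]] := gallai gs gi ub p0 N0 x0 z0 xz y0 p' N' w'.
      exact: (hxy m1).
    exact: (hyz m1).
  pose f x := [set y | `[< r x y >]].
  have fE x y : f x = f y <-> r x y.
    split=> [e|rxy].
      have : y \in f y by rewrite inE; apply/asboolP; left.
      by rewrite -e inE => /asboolP.
    apply/setP => z; rewrite !inE; apply/asboolP/asboolP.
      exact: (rt _ _ _ (rs _ _ rxy)).
    exact: rt.
  exists finset.set0, f; split.
    move=> x y _ _ gxy; apply/fE; right => m0 [p0 N0] x0 y0.
    by have := max_pairing_free gs gi ub p0 N0 x0 y0; rewrite gxy.
  (* Distinct vertices missed by [m] are unrelated, so there are at least as many colours as missed
     vertices. *)
  have inj : {in ~: covered m &, injective f}.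
    move=> x y; rewrite !inE !negbK => /eqP ex /eqP ey /fE [//|h].
    by case: (h m).
  have := card_in_imset inj; have := cardsC (covered m); rewrite mN.
  have := subset_leq_card (imsetS f (finset.subsetT (~: covered m))).
  by rewrite finset.setC0 cards0; lia.
(* For [N = 0] a single edge would already be a forbidden pairing, so the graph has no edges and
   each vertex gets its own colour. *)
exists finset.set0, (fun x => [set x]); split.
  move=> x y _ _ gxy; have := ub _ (rematch_pairing gs (pairing_id g) gxy _ erefl).
  have xy : x != y by apply: contraTneq gxy => ->; rewrite gi.
  move/(_ xy); rewrite mul0n leqn0 cards_eq0 => /eqP /setP /(_ x).
  by rewrite !inE /rematch eqxx eq_sym xy.
by rewrite finset.setC0 cards0 card_imset ?cardsT ?addn0 //; exact: set1_inj.
Qed.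

End Pairing.

(** * Positive supersolutions and the largest eigenvalue *)

Section Spectral.

Variables (R : realType) (n : nat).
Implicit Types (g h : rel 'I_n) (a x y : R) (u v w : 'I_n -> R).

Definition aop g a u (i : 'I_n) : R := \sum_j A_alpha g a i j * u j.

Lemma aopE g a u i :
  aop g a u i = a * (deg g i)%:R * u i + (1 - a) * \sum_(j | g i j) u j.
Proof.
rewrite /aop (eq_bigr (fun j => a * (deg g i)%:R * u j * (i == j)%:R +
  (1 - a) * (u j * (g i j)%:R))); last by move=> j _; rewrite mxE; ring.
rewrite big_split /=; congr (_ + _); last first.
  by rewrite -big_distrr /= [in RHS]big_mkcond /=; congr (_ * _); apply: eq_bigr => j _;
     case: (g i j); rewrite ?mulr1 ?mulr0.
rewrite (bigD1 i) //= eqxx mulr1 big1 ?addr0 // => j; rewrite eq_sym => /negPf->.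
by rewrite mulr0.
Qed.

Lemma A_alpha_sym g a i j : symmetric g -> A_alpha g a i j = A_alpha g a j i.
Proof.
move=> gs; rewrite !mxE gs [j == i]eq_sym.
by case: eqVneq => [->//|_]; rewrite !mulr0 !mul0r.
Qed.

Lemma A_alpha_ge0 g a i j : 0 <= a <= 1 -> 0 <= A_alpha g a i j.
Proof.
by case/andP=> a0 a1; rewrite mxE addr_ge0 ?mulr_ge0 ?ler0n ?subr_ge0.
Qed.

(** [eigenvalue] speaks of row vectors; symmetry of the matrix turns them into eigenfunctions of
    [aop]. *)
Lemma eigenvalue_aopP g a y : symmetric g ->
  eigenvalue (A_alpha g a) y <->
  exists u, (exists i, u i != 0) /\ forall i, aop g a u i = y * u i.
Proof.
move=> gs; split.
  case/eigenvalueP => v e v0; exists (fun i => v 0 i); split.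
    by apply/existsP; apply: contraNT v0 => /existsPn h; apply/eqP/rowP => i;
       rewrite mxE; apply/eqP; rewrite -[_ == _]negbK h.
  move=> i; have /rowP/(_ i) := e; rewrite !mxE => <-.
  by apply: eq_bigr => j _; rewrite A_alpha_sym // mulrC.
case=> u [[i ui] e]; apply/eigenvalueP; exists (\row_j u j).
  apply/rowP => j; rewrite !mxE -e; apply: eq_bigr => k _.
  by rewrite mxE A_alpha_sym // mulrC.
by apply: contraNneq ui => /rowP/(_ i); rewrite !mxE => ->.
Qed.

Lemma aop_adjoint g a u v : symmetric g ->
  \sum_i v i * aop g a u i = \sum_i u i * aop g a v i.
Proof.
move=> gs; rewrite /aop; under eq_bigr do rewrite big_distrr.
rewrite exchange_big /=; apply: eq_bigr => i _; rewrite big_distrr /=.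
by apply: eq_bigr => j _; rewrite A_alpha_sym //; ring.
Qed.

Section Supersolution.

Variables (g : rel 'I_n) (a x : R) (v : 'I_n -> R).
Hypotheses (gs : symmetric g) (a01 : 0 <= a <= 1).
Hypotheses (v_gt0 : forall i, 0 < v i) (vx : forall i, aop g a v i <= x * v i).

Let norm_aop u y : (forall i, aop g a u i = y * u i) ->
  forall i, y * `|u i| <= aop g a (fun i => `|u i|) i.
Proof.
move=> e i; apply: le_trans (_ : `|y * u i| <= _).
  by rewrite normrM ler_wpM2r // ler_norm.
rewrite -e; apply: le_trans (ler_norm_sum _ _ _) _; apply: ler_sum => j _.
by rewrite normrM (ger0_norm (A_alpha_ge0 g i j a01)).
Qed.

(** For an eigenfunction [u], pairing [|u|] with [v] gives [y <v,|u|> <= <v,A|u|> = <Av,|u|> <= x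
    <v,|u|>], and [<v,|u|>] is positive. *)
Lemma eigenvalue_le y : eigenvalue (A_alpha g a) y -> y <= x.
Proof.
move/(eigenvalue_aopP _ _ gs) => [u [[i ui] e]].
have S0 : 0 < \sum_j v j * `|u j|.
  rewrite (bigD1 i) //= ltr_pwDl ?mulr_gt0 ?normr_gt0 //.
  by apply: sumr_ge0 => j _; rewrite mulr_ge0 ?(ltW (v_gt0 j)).
rewrite -(ler_pM2r S0) !big_distrr /=.
apply: le_trans (_ : \sum_j v j * aop g a (fun j => `|u j|) j <= _).
  apply: ler_sum => j _; rewrite mulrCA ler_wpM2l ?(ltW (v_gt0 j)) //.
  exact: norm_aop.
rewrite aop_adjoint //; apply: ler_sum => j _.
by rewrite mulrA [leRHS]mulrC ler_wpM2l.
Qed.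

(** By adjointness the nonnegative defects of [|u|] and of [v] sum to zero, so all vanish. Thus
    [|u|] is an eigenfunction; a zero of it would spread along edges to the whole connected graph.
    So [|u|] is positive everywhere and [v] has no slack. *)
Lemma eigenvalue_supersolution_eq : irreflexive g -> a < 1 ->
  (forall i j, connect g i j) -> eigenvalue (A_alpha g a) x ->
  forall i, aop g a v i = x * v i.
Proof.
move=> gi a1 conn /(eigenvalue_aopP _ _ gs) [u [[i0 ui0] e]].
pose w i := `|u i|.
have d1 i : 0 <= v i * (aop g a w i - x * w i).
  by rewrite mulr_ge0 ?(ltW (v_gt0 i)) // subr_ge0 norm_aop.
have d2 i : 0 <= w i * (x * v i - aop g a v i).
  by rewrite mulr_ge0 ?normr_ge0 // subr_ge0.
have z : \sum_i (v i * (aop g a w i - x * w i) + w i * (x * v i - aop g a v i)) = 0.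
  rewrite (eq_bigr (fun i => v i * aop g a w i - w i * aop g a v i)); last first.
    by move=> i _; ring.
  by rewrite sumrB aop_adjoint // subrr.
have z' i : v i * (aop g a w i - x * w i) + w i * (x * v i - aop g a v i) = 0.
  have h j : true -> 0 <= v j * (aop g a w j - x * w j) + w j * (x * v j - aop g a v j).
    by move=> _; rewrite addr_ge0.
  by move/eqP: z; rewrite psumr_eq0 // => /allP/(_ i (mem_index_enum i))/eqP.
have wx i : aop g a w i = x * w i.
  move: (z' i) => /eqP; rewrite paddr_eq0 // => /andP[/eqP/eqP].
  by rewrite mulf_eq0 gt_eqF //= subr_eq0 => /eqP.
have wstep i j : g i j -> w i = 0 -> w j = 0.
  move=> gij wi; have := wx i; rewrite aopE wi !mulr0 add0r => /eqP.
  rewrite mulf_eq0 subr_eq0 gt_eqF //= psumr_eq0 ?normr_ge0 // => [|k _]; last exact: normr_ge0.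
  by move=> /allP/(_ j (mem_index_enum j)); rewrite gij => /eqP.
have w0 i : w i != 0.
  apply/negP => /eqP wi; have /connectP[p pp last_p] := conn i i0.
  case/negP: ui0; rewrite -normr_eq0 -/(w i0) last_p {last_p} -/(w _).
  elim: p i wi pp => [|j p IH] i wi /=; first by rewrite wi.
  by case/andP=> gij; apply: IH; exact: wstep wi.
move=> i; move: (z' i) => /eqP; rewrite paddr_eq0 // => /andP[_].
by rewrite mulf_eq0 (negPf (w0 i)) /= subr_eq0 => /eqP.
Qed.

(** The sign of [x] covers an empty set of eigenvalues, whose supremum is 0 by convention. *)
Lemma rho_alpha_le : 0 <= x -> rho_alpha g a <= x.
Proof.
move=> x0; rewrite /rho_alpha.
have [ne|/set0P/negP] := pselect (classical_sets.nonempty [set y | eigenvalue (A_alpha g a) y]%classic).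
  by apply: ge_sup ne _ => y /eigenvalue_le.
by rewrite negbK => /eqP ->; rewrite sup0.
Qed.

Lemma rho_alpha_eigenvalue : eigenvalue (A_alpha g a) x -> rho_alpha g a = x.
Proof.
move=> ex; apply/le_anti/andP; split.
  by apply: ge_sup => [|y /eigenvalue_le//]; exists x.
by apply: ub_le_sup => //; exists x => y /eigenvalue_le.
Qed.

End Supersolution.

(** The eigenvalues are finitely many roots, so the supremum is attained as soon as there is one; a
    nonzero supremum excludes the empty set. *)
Lemma eigenvalue_rho g a : rho_alpha g a != 0 -> eigenvalue (A_alpha g a) (rho_alpha g a).
Proof.
move=> r0; pose s := rootsR (char_poly (A_alpha g a)).
have p0 : char_poly (A_alpha g a) != 0 by exact/monic_neq0/char_poly_monic.
have sE y : (y \in s) = eigenvalue (A_alpha g a) y.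
  by rewrite eigenvalue_root_char -(roots_on_rootsR p0) inE.
have -> : rho_alpha g a = sup [set y | y \in s]%classic.
  by rewrite /rho_alpha; congr sup; apply/seteqP; split => y /=; rewrite sE.
have : s != [::].
  apply: contra r0 => /eqP s0; apply/eqP; rewrite /rho_alpha -[RHS](@sup0 R); congr sup.
  by apply/seteqP; split => y //=; rewrite -sE s0.
rewrite -sE; elim: s {sE} => // y [|z s] IH _.
  rewrite (_ : [set y0 | _]%classic = [set y]%classic) ?sup1 ?mem_head //.
  by apply/seteqP; split => y0 /=; rewrite inE => /eqP.
have {}IH := IH isT; set m := sup _ in IH.
have ub t : t \in z :: s -> t <= m.
  move=> ht; apply: ub_le_sup => //.
  exists (\sum_(t <- z :: s) `|t|) => t' /= ht'.
  rewrite (big_rem t') //=; apply: le_trans (ler_norm _) _.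
  by rewrite lerDl sumr_ge0.
suff -> : sup [set y0 | y0 \in y :: z :: s]%classic = Num.max y m.
  by case: (leP y m) => _; rewrite !inE ?eqxx //; rewrite inE in IH; rewrite IH orbT.
have U t : t \in y :: z :: s -> t <= Num.max y m.
  by rewrite inE le_max => /orP[/eqP->|/ub->]; rewrite ?lexx ?orbT.
apply/le_anti/andP; split.
  by apply: ge_sup => [|t /U//]; exists y; rewrite /= mem_head.
apply: ub_le_sup; first by exists (Num.max y m) => t /U.
by case: (leP y m) => _; rewrite /= inE ?eqxx ?IH ?orbT.
Qed.

Lemma graph_iso_deg g h (s : 'S_n) i :
  (forall i j, g i j = h (s i) (s j)) -> deg g i = deg h (s i).
Proof.
move=> e; rewrite /deg -(card_imset _ (@perm_inj _ s)).
apply: eq_card => j; rewrite inE; apply/imsetP/idP.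
  by case=> k; rewrite inE e => hk ->.
by move=> hj; exists ((s^-1)%g j); rewrite ?inE ?e permKV.
Qed.

Lemma graph_iso_sym g h : graph_iso g h -> graph_iso h g.
Proof.
by case=> s e; exists (s^-1)%g => i j; rewrite e !permKV.
Qed.

Lemma graph_iso_eigenvalue g h a y : graph_iso g h -> symmetric g -> symmetric h ->
  eigenvalue (A_alpha g a) y -> eigenvalue (A_alpha h a) y.
Proof.
case=> s e gs hs /(eigenvalue_aopP _ _ gs) [u [[i ui] eu]].
apply/(eigenvalue_aopP _ _ hs); exists (fun i => u ((s^-1)%g i)); split.
  by exists (s i); rewrite permK.
move=> j; rewrite -eu !aopE; congr (_ * _%:R * _ + _ * _).
  by rewrite (graph_iso_deg _ e) permKV.
rewrite (reindex_inj (@perm_inj _ s)) /=.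
by apply: eq_big => k; rewrite ?permK // e permKV.
Qed.

Lemma graph_iso_rho g h a : symmetric g -> symmetric h -> graph_iso g h ->
  rho_alpha g a = rho_alpha h a.
Proof.
move=> gs hs i; rewrite /rho_alpha; congr sup; apply/seteqP; split => y /=.
  exact: graph_iso_eigenvalue.
by apply: graph_iso_eigenvalue => //; exact: graph_iso_sym.
Qed.

End Spectral.

(* The quotient matrix of A_alpha(K_s v (K_(2(h-s)+1) u co-K_(s+k-1))), with
   n = 2h+k, has this characteristic polynomial. *)
Definition charcubic (R : realType) (H K a s x : R) : R :=
  let b := 1 - a in
  let d1 := a * (2 * H + K) - 1 + b * s in
  let d2 := a * s + 2 * (H - s) in
  let d3 := a * s in
  (x - d1) * (x - d2) * (x - d3)
  - b ^+ 2 * s * ((2 * (H - s) + 1) * (x - d3) + (s + K - 1) * (x - d2)).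

(** * Effect of adding edges on the operator *)

Section Operator.

Variables (R : realType) (n : nat) (a : R) (g g' : rel 'I_n) (v : 'I_n -> R).
Hypotheses (a0 : 0 <= a) (a1 : a < 1) (v0 : forall i, 0 < v i).
Hypothesis gg' : subrel g g'.

Let deg_le i : (deg g i)%:R <= (deg g' i)%:R :> R.
Proof.
by rewrite ler_nat; apply/subset_leq_card/fintype.subsetP => j; rewrite !inE => /gg'.
Qed.

Let sum_diff i : \sum_(j | g' i j) v j - \sum_(j | g i j) v j =
  \sum_(j | g' i j && ~~ g i j) v j.
Proof.
rewrite (bigID (g i)) /= addrAC (eq_bigl (g i)) ?subrr ?add0r // => j.
by apply: andb_idl => /gg'.
Qed.

Lemma aop_mono i : aop g a v i <= aop g' a v i.
Proof.
rewrite !aopE lerD // ?ler_wpM2r ?ler_wpM2l ?(ltW (v0 i)) ?subr_ge0 ?(ltW a1) //.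
rewrite -subr_ge0 sum_diff.
by apply: sumr_ge0 => j _; apply: ltW.
Qed.

(** Each additional neighbour contributes a positive weight times [1 - a > 0], so equality at [i]
    leaves no room for one. *)
Lemma aop_mono_eq i : aop g a v i = aop g' a v i -> g i =1 g' i.
Proof.
rewrite !aopE => e.
have h1 : a * (deg g i)%:R * v i <= a * (deg g' i)%:R * v i.
  by rewrite ler_wpM2r ?(ltW (v0 i)) ?ler_wpM2l.
have h2 : (1 - a) * (\sum_(j | g' i j) v j - \sum_(j | g i j) v j) = 0.
  apply/le_anti/andP; split; last first.
    by rewrite sum_diff mulr_ge0 ?subr_ge0 ?(ltW a1) ?sumr_ge0 // => j _; apply: ltW.
  by rewrite mulrBr; lra.
move/eqP: h2; rewrite sum_diff mulf_eq0 subr_eq0 gt_eqF //=.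
rewrite psumr_eq0 => [/allP h j|j _]; last exact: ltW.
apply/idP/idP => [/gg'//|g'ij]; apply: contraT => ngij.
by have := h j (mem_index_enum j); rewrite g'ij ngij /= gt_eqF.
Qed.

End Operator.

(** * The test vector on a graph saturated with respect to [S] and a colouring *)

Section Saturated.

Variables (n : nat) (S : {set 'I_n}) (f : 'I_n -> {set 'I_n}).

(** The edge-maximal simple graph in which edges avoiding [S] join equal colours: [S] is joined to
    everything and each class is a clique. *)
Definition saturated : rel 'I_n :=
  fun i j => (i != j) && [|| i \in S, j \in S | f i == f j].

Definition class_size (i : 'I_n) : nat := #|[set j in ~: S | f j == f i]|.

Lemma saturated_sym : symmetric saturated.
Proof. by move=> i j; rewrite /saturated eq_sym orbCA [f j == _]eq_sym. Qed.

Lemma class_size_gt0 i : i \notin S -> (0 < class_size i)%N.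
Proof. by move=> iS; apply/card_gt0P; exists i; rewrite !inE iS eqxx. Qed.

(** Every other class has at least one vertex. *)
Lemma class_size_le i : i \notin S ->
  (class_size i + #|f @: ~: S| <= (n - #|S|).+1)%N.
Proof.
move=> iS; pose C := [set j in ~: S | f j == f i].
have sC : C \subset ~: S by apply/fintype.subsetP => j; rewrite inE => /andP[].
have h1 : (#|f @: ~: S| <= #|f i |: f @: (~: S :\: C)|)%N.
  apply/subset_leq_card/fintype.subsetP => _ /imsetP[j jS ->].
  rewrite inE; case: (eqVneq (f j) (f i)) => [->|nf]; first by rewrite inE eqxx.
  by apply/orP; right; apply: imset_f; move: jS; rewrite !inE (negPf nf) andbF.
have h2 : (#|f @: (~: S :\: C)| <= #|~: S :\: C|)%N by exact: leq_imset_card.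
have h3 : #|~: S :\: C| = (#|~: S| - #|C|)%N by rewrite cardsD (finset.setIidPr sC).
have h4 := cardsC S; rewrite card_ord in h4.
have h5 := subset_leq_card sC.
rewrite cardsU1 in h1; rewrite /class_size -/C.
have h6 := leq_b1 (f i \notin f @: (~: S :\: C)).
by move: (nat_of_bool _) h1 h6 => z; lia.
Qed.

Lemma class_size_eq i j : f i = f j -> class_size i = class_size j.
Proof. by rewrite /class_size => ->. Qed.

(** Each class of size [c] contributes [c] terms [1/c]; this converts sums over vertices into the
    number of classes. *)
Lemma sum_inv_class_size (R : realType) :
  \sum_(i in ~: S) (class_size i)%:R^-1 = #|f @: ~: S|%:R :> R.
Proof.
rewrite (partition_big_imset f) /= -sum1_card natr_sum; apply: eq_bigr => c.
case/imsetP => i iS ->; rewrite (eq_bigr (fun=> (class_size i)%:R^-1)); last first.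
  by move=> j /andP[_ /eqP e]; rewrite (class_size_eq e).
rewrite sumr_const -[X in _ *+ X]/(#|_|).
have -> : #|[pred j | (j \in ~: S) && (f j == f i)]| = class_size i.
  by apply: eq_card => j; rewrite !inE.
rewrite -[LHS]mulr_natr mulVf // pnatr_eq0 -lt0n class_size_gt0 //.
by rewrite inE in iS.
Qed.

Lemma deg_saturated_in i : i \in S -> deg saturated i = n.-1.
Proof.
move=> iS; rewrite /deg (_ : [set _ | _] = ~: [set i]).
  by rewrite cardsC1 card_ord.
by apply/setP => j; rewrite !inE /saturated iS /= andbT eq_sym.
Qed.

Lemma deg_saturated_out i : i \notin S -> deg saturated i = (#|S| + class_size i).-1.
Proof.
move=> iS; pose C := [set j in ~: S | f j == f i].
have -> : (#|S| + class_size i)%N = #|S :|: C|.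
  rewrite /class_size -/C cardsU (_ : S :&: C = finset.set0) ?cards0 ?subn0 //.
  by apply/setP => j; rewrite !inE; case: (j \in S).
rewrite (cardsD1 i (S :|: C)) !inE iS eqxx orbT add1n /= /deg; apply: eq_card => j.
rewrite !inE /saturated (negPf iS) /= eq_sym [f i == _]eq_sym.
by case: (j \in S).
Qed.

Section Eigenvector.

Variables (R : realType) (h k : nat) (a x : R).
Hypothesis hn : n = (h * 2 + k)%N.
Hypotheses (s0 : (0 < #|S|)%N) (sh : (#|S| <= h)%N) (qk : (#|S| + k <= #|f @: ~: S|)%N).
Hypotheses (a0 : 0 <= a) (a1 : a < 1).
Let s : R := #|S|%:R.
(** The largest size a class can have when there are at least [s + k] of them; the bound on [x]
    below amounts to [X - m > 0]. *)
Let m : R := 2 * (h%:R - s) + 1.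
Let b : R := 1 - a.
Hypothesis xd : a * s + 2 * (h%:R - s) < x.

(** With weight 1 on [S], the eigenvalue equation at a vertex of a class of size [c] reads
    [(x - a s + 1 - c) w = b s]; the weight solves it. *)
Definition class_weight (i : 'I_n) : R :=
  if i \in S then 1 else b * s / (x - a * s + 1 - (class_size i)%:R).

Let X := x - a * s + 1.

Let class_size_le_m i : i \notin S -> (class_size i)%:R <= m.
Proof.
move=> iS; have := class_size_le iS => le.
have : (class_size i)%:R <= (2 * (h - #|S|) + 1)%N%:R :> R by rewrite ler_nat; lia.
by rewrite natrD natrM natrB.
Qed.

Let class_size_ge1 i : i \notin S -> 1 <= (class_size i)%:R :> R.
Proof. by move=> /class_size_gt0; rewrite ler1n. Qed.

Let s_gt0 : 0 < s. Proof. by rewrite ltr0n. Qed.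
Let b_gt0 : 0 < b. Proof. by rewrite subr_gt0. Qed.
Let Xm : 0 < X - m. Proof.
have -> : X - m = x - (a * s + 2 * (h%:R - s)) by rewrite /X /m; ring.
by rewrite subr_gt0.
Qed.
Let m_ge1 : 1 <= m.
Proof. by rewrite lerDr mulr_ge0 ?subr_ge0 ?ler_nat. Qed.
Let Xc i : i \notin S -> 0 < X - (class_size i)%:R.
Proof. by move=> /class_size_le_m; move: Xm; lra. Qed.

Lemma class_weight_gt0 i : 0 < class_weight i.
Proof.
rewrite /class_weight; case: ifPn => // iS.
by rewrite divr_gt0 ?mulr_gt0 // Xc.
Qed.

Lemma aop_class_weight_out i : i \notin S ->
  aop saturated a class_weight i = x * class_weight i.
Proof.
move=> iS; rewrite aopE deg_saturated_out //.
have c0 := class_size_gt0 iS; have Xci := Xc iS.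
rewrite -subn1 natrB; last by lia.
rewrite natrD -/s.
have -> : \sum_(j | saturated i j) class_weight j =
          s + ((class_size i)%:R - 1) * class_weight i.
  rewrite (bigID (mem S)) /=; congr (_ + _).
    rewrite (eq_bigr (fun=> 1)); last by move=> j /andP[_ jS]; rewrite /class_weight jS.
    rewrite sumr_const; congr (_%:R); apply: eq_card => j.
    rewrite unfold_in /= /saturated; case jS : (j \in S) => //=; rewrite ?andbF // orbT !andbT.
    by apply: contraNneq iS => ->.
  rewrite (eq_bigr (fun=> class_weight i)); last first.
    move=> j /andP[/andP[_]]; rewrite (negPf iS) /= => h1 jS.
    move: h1; rewrite (negPf jS) /= => /eqP e.
    by rewrite /class_weight (negPf iS) (negPf jS) (class_size_eq e).
  rewrite sumr_const -[LHS]mulr_natl; congr (_ * _).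
  rewrite -[1]/(1%:R) -natrB //; congr (_%:R).
  rewrite subn1 /class_size (cardsD1 i) !inE iS eqxx /=; apply: eq_card => j.
  rewrite !inE [LHS]unfold_in /= /saturated (negPf iS) /= eq_sym [f i == _]eq_sym.
  by case: (j \in S); rewrite /= ?andbF ?andbT.
rewrite /class_weight (negPf iS) -/X -/b.
have X0 : X - (class_size i)%:R != 0 by rewrite gt_eqF.
have -> : x = X - (class_size i)%:R + (class_size i)%:R + a * s - 1.
  by rewrite /X; ring.
move: (X - _) X0 => Y Y0; rewrite /b.
by field.
Qed.

Definition chord_gap (i : 'I_n) : R :=
  X * ((class_size i)%:R - 1) * (m - (class_size i)%:R)
  / ((class_size i)%:R * (X - (class_size i)%:R) * (X - m) * (X - 1)).

(* c / (X - c) is convex in c, and chord_gap measures how far it lies below its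
   chord over [1, m]. *)
Lemma aop_class_weight_in i : i \in S ->
  x * class_weight i - aop saturated a class_weight i =
  charcubic h%:R k%:R a s x / ((X - m) * (X - 1))
  + b ^+ 2 * s * (\sum_(j in ~: S) chord_gap j
     + (#|f @: ~: S|%:R - (s + k%:R)) * (m / ((X - m) * (X - 1)))).
Proof.
move=> iS; rewrite aopE deg_saturated_in //.
have X1 : 0 < X - 1 by move: Xm m_ge1; lra.
have nR : n%:R = 2 * h%:R + k%:R :> R.
  by rewrite [in LHS]hn natrD natrM; ring.
have sumS : \sum_(j | saturated i j) class_weight j =
    s - 1 + \sum_(j in ~: S) class_weight j.
  rewrite (bigID (mem S)) /=; congr (_ + _).
    rewrite (eq_bigr (fun=> 1)); last by move=> j /andP[_ jS]; rewrite /class_weight jS.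
    rewrite sumr_const -[1]/(1%:R) -natrB //; congr (_%:R).
    rewrite subn1 (cardsD1 i) iS /=; apply: eq_card => j.
    by rewrite !inE [LHS]unfold_in /= /saturated iS /= andbT eq_sym.
  apply: eq_bigl => j; rewrite /saturated iS inE /= andbT.
  by apply: andb_idl; apply: contraNneq => <-.
(* The chord is [(X c - m) / ((X - m)(X - 1))]. Divided by [c] and summed over vertices, its two
   terms give the number of vertices outside [S] and the number of classes. *)
have sumC : \sum_(j in ~: S) class_weight j = b * s *
    (X / ((X - m) * (X - 1)) * (2 * h%:R + k%:R - s)
     - m / ((X - m) * (X - 1)) * #|f @: ~: S|%:R - \sum_(j in ~: S) chord_gap j).
  have -> : 2 * h%:R + k%:R - s = \sum_(j in ~: S) 1 :> R.
    rewrite sumr_const cardsCs finset.setCK card_ord natrB ?nR //.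
    by apply: leq_trans sh _; lia.
  rewrite -sum_inv_class_size !big_distrr -!sumrB big_distrr /=; apply: eq_bigr => j.
  rewrite inE => jS; rewrite /class_weight (negPf jS) /chord_gap -/X; congr (_ * _).
  have c0 : (class_size j)%:R != 0 :> R by rewrite pnatr_eq0 -lt0n class_size_gt0.
  field; rewrite c0 !gt_eqF //; exact: Xc.
have -> : n.-1%:R = 2 * h%:R + k%:R - 1 :> R.
  by rewrite -subn1 natrB ?nR //; lia.
rewrite sumS sumC /class_weight iS; move: (\sum_(j in _) chord_gap j) => G.
rewrite /charcubic -/b.
have e3 : x - a * s = X - 1 by rewrite /X; ring.
have e2 : x - (a * s + 2 * (h%:R - s)) = X - m by rewrite /X /m; ring.
rewrite e3 e2; have Xm0 : X - m != 0 by rewrite gt_eqF.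
have X10 : X - 1 != 0 by rewrite gt_eqF.
rewrite /b /m; field.
by rewrite X10 Xm0.
Qed.

Let q_slack_ge0 :
  0 <= (#|f @: ~: S|%:R - (s + k%:R)) * (m / ((X - m) * (X - 1))) :> R.
Proof.
have X1 : 0 < X - 1 by move: Xm m_ge1; lra.
have m0 : 0 <= m by move: m_ge1; lra.
by rewrite mulr_ge0 ?divr_ge0 ?mulr_ge0 ?(ltW Xm) ?(ltW X1) // subr_ge0 -natrD ler_nat.
Qed.

Let chord_gap_ge0 j : j \in ~: S -> 0 <= chord_gap j.
Proof.
rewrite inE => jS; have c1 := class_size_ge1 jS; have cm := class_size_le_m jS.
have X1 : 0 < X - 1 by move: Xm m_ge1; lra.
have X0 : 0 <= X by move: X1; lra.
by rewrite /chord_gap divr_ge0 ?mulr_ge0 ?(ltW Xm) ?(ltW X1) ?(ltW (Xc jS)) // subr_ge0.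
Qed.

Lemma class_weight_supersolution : 0 <= charcubic h%:R k%:R a s x ->
  forall i, aop saturated a class_weight i <= x * class_weight i.
Proof.
move=> f0 i; case: (boolP (i \in S)) => iS; last by rewrite aop_class_weight_out.
have X1 : 0 < X - 1 by move: Xm m_ge1; lra.
have G0 : 0 <= \sum_(j in ~: S) chord_gap j by exact: sumr_ge0.
rewrite -subr_ge0 aop_class_weight_in // addr_ge0 ?divr_ge0 ?mulr_ge0 ?(ltW Xm) ?(ltW X1) ?(ltW b_gt0) //.
by rewrite addr_ge0.
Qed.

Lemma class_weight_eigenvector : charcubic h%:R k%:R a s x = 0 ->
  #|f @: ~: S| = (#|S| + k)%N ->
  (forall j, j \notin S -> class_size j = 1 \/ class_size j = ((h - #|S|) * 2).+1)%N ->
  forall i, aop saturated a class_weight i = x * class_weight i.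
Proof.
move=> f0 q sz i; case: (boolP (i \in S)) => iS; last by rewrite aop_class_weight_out.
apply/esym/eqP; rewrite -subr_eq0 aop_class_weight_in // f0 mul0r add0r q natrD subrr mul0r addr0.
rewrite big1 ?mulr0 // => j; rewrite inE => /sz[] e; rewrite /chord_gap e.
  by rewrite subrr mulr0 !mul0r.
rewrite (_ : _ - _%:R = 0) ?mulr0 ?mul0r // -natr1 natrM natrB // /m.
by ring.
Qed.

(** At a vertex of [S] the slack combines three nonnegative quantities: the cubic, the chord gaps
    and the excess of classes. Equality kills each, and a chord gap vanishes only at the endpoints 1
    and [m]. *)
Lemma class_weight_eigenvectorP : 0 <= charcubic h%:R k%:R a s x ->
  (forall i, aop saturated a class_weight i = x * class_weight i) ->
  [/\ charcubic h%:R k%:R a s x = 0, #|f @: ~: S| = (#|S| + k)%N &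
  forall j, j \notin S -> (class_size j = 1 \/ class_size j = ((h - #|S|) * 2).+1)%N].
Proof.
move=> f0 e; have [i iS] := card_gt0P s0.
have X1 : 0 < X - 1 by move: Xm m_ge1; lra.
have XX : 0 < (X - m) * (X - 1) by exact: mulr_gt0.
have X0 : 0 < X by move: X1; lra.
have := aop_class_weight_in iS; rewrite e subrr => /esym/eqP.
have G0 : 0 <= \sum_(j in ~: S) chord_gap j by exact: sumr_ge0.
rewrite paddr_eq0; first last.
- by rewrite mulr_ge0 ?mulr_ge0 ?(ltW b_gt0) // addr_ge0.
- by rewrite divr_ge0 // ltW.
have bs : 0 < b ^+ 2 * s by rewrite !mulr_gt0.
rewrite mulf_eq0 invr_eq0 (gt_eqF XX) orbF => /andP[/eqP->].
rewrite mulf_eq0 (gt_eqF bs) paddr_eq0 // => /andP[/eqP G /eqP Q].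
split=> //.
  move: Q => /eqP; rewrite !mulf_eq0 invr_eq0 (gt_eqF XX) orbF.
  rewrite [m == 0]gt_eqF ?orbF; last by move: m_ge1; lra.
  by rewrite subr_eq0 -natrD eqr_nat => /eqP.
move=> j jS; have jS' : j \in ~: S by rewrite inE.
have : chord_gap j == 0.
  have /psumr_eq0P h0 := chord_gap_ge0.
  by rewrite (h0 G).
rewrite /chord_gap !mulf_eq0 invr_eq0 !mulf_eq0 (gt_eqF X0) (gt_eqF Xm) (gt_eqF X1).
rewrite (gt_eqF (Xc jS)) pnatr_eq0 gtn_eqF ?class_size_gt0 //= !orbF.
rewrite !subr_eq0 => /orP[|/eqP em]; first by rewrite pnatr_eq1 => /eqP; left.
right; apply/eqP; rewrite -(eqr_nat R) -em -natr1 natrM natrB // /m.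
by apply/eqP; ring.
Qed.

End Eigenvector.
End Saturated.

(** * From the Tutte-Berge set to the extremal family *)

Section Graph.

Variable n : nat.
Implicit Types (g : rel 'I_n) (S : {set 'I_n}).

Lemma covered_le_matching_number g m :
  pairing g m -> (#|covered m| <= matching_number g * 2)%N.
Proof.
case=> mK mg; rewrite card_covered // leq_pmul2r // /matching_number.
apply: (@leq_bigmax_cond _ _ (fun M : {set {set 'I_n}} => #|M|)).
rewrite /is_matching trivIset_pairs // andbT.
apply/forallP => e; apply/implyP => /imsetP[x + ->].
rewrite inE => xm; apply/existsP; exists x; apply/existsP; exists (m x).
by rewrite eqxx mg.
Qed.

Lemma connectivity_le_cut g S t : t_connected g t -> is_cut g S -> (t <= #|S|)%N.
Proof.
move=> tc cut; apply: leq_trans tc _.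
rewrite /connectivity; have := mem_index_enum S.
elim: (index_enum _) => // A r IH; rewrite inE big_cons => /orP[/eqP <-|/IH le].
  by rewrite cut geq_minl.
by case: ifP => // _; apply: leq_trans le; exact: geq_minr.
Qed.

Lemma connected_of_t_connected g t : (0 < t)%N -> t_connected g t ->
  forall i j, connect g i j.
Proof.
move=> t0 tc i j; have ncut : ~~ is_cut g finset.set0.
  apply: contraL t0 => /(connectivity_le_cut tc).
  by rewrite cards0 leqn0 => /eqP->.
move: ncut; rewrite /is_cut negb_or negbK => /andP[_ /forallP/(_ i)].
rewrite finset.setC0 inE => /forallP/(_ j); rewrite inE /=.
by rewrite (eq_connect (e' := g)) // => u v; rewrite /= !inE !andbT.
Qed.

(** The colour is constant along any path avoiding [S], so two colours give two vertices that [S]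
    separates. *)
Lemma is_cut_colouring g S (f : 'I_n -> {set 'I_n}) :
  (forall x y, x \notin S -> y \notin S -> g x y -> f x = f y) ->
  (1 < #|f @: ~: S|)%N -> is_cut g S.
Proof.
move=> fE /card_gt1P[_ [_ [/imsetP[x xS ->] /imsetP[y yS ->] nf]]].
rewrite /is_cut orbC; apply/orP; left; apply: contra nf.
move=> /forallP/(_ x); rewrite xS => /forallP/(_ y); rewrite yS /=.
case/connectP => p pp ->; apply/eqP.
elim: p x {xS yS} pp => //= z p IH x /andP[/and3P[xz xS zS] /IH <-].
exact: fE.
Qed.

Lemma card_ord_lt s : (s <= n)%N -> #|[set i : 'I_n | (i < s)%N]| = s.
Proof.
move=> sn; rewrite -sum1_card.
rewrite (eq_bigl (fun i : 'I_n => (i < s)%N)); last by move=> i; rewrite inE.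
by rewrite -(big_ord_widen n (fun=> 1%N) sn) sum1_card card_ord.
Qed.

Lemma perm_of_labels (p q : 'I_n -> nat) :
  (forall c, #|[set i | p i == c]| = #|[set i | q i == c]|) ->
  exists s : 'S_n, forall i, p i = q (s i).
Proof.
move=> e; have : perm_eq [tuple p i | i < n] [tuple q i | i < n].
  apply/allP => c _ /=; rewrite !count_map -!size_filter -!enumT.
  have cE (r : 'I_n -> nat) : size [seq i <- enum 'I_n | preim r (pred1 c) i] =
      #|[set i | r i == c]|.
    by rewrite cardE /enum_mem -filter_predI; congr size; apply: eq_filter => i; rewrite !inE andbT.
  by rewrite !cE e.
case/tuple_permP => s /val_inj es; exists s => i.
by have := congr1 (fun t => tnth t i) es; rewrite !tnth_mktuple.
Qed.

Lemma perm_two_sets (S B S' B' : {set 'I_n}) :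
  [disjoint S & B] -> [disjoint S' & B'] -> #|S| = #|S'| -> #|B| = #|B'| ->
  exists s : 'S_n, forall i, (s i \in S') = (i \in S) /\ (s i \in B') = (i \in B).
Proof.
pose lab (S B : {set 'I_n}) (i : 'I_n) : nat :=
  if i \in S then 0%N else if i \in B then 1%N else 2.
have cl (A C : {set 'I_n}) c : [disjoint A & C] -> #|[set i | lab A C i == c]| =
    (if c is c'.+1 then if c' is c''.+1 then if c'' is _.+1 then 0 else n - (#|A| + #|C|)
     else #|C| else #|A|)%N.
  move=> dAC; have AC i : i \in A -> i \in C = false.
    by move=> iA; apply: (disjointFr dAC).
  case: c => [|[|[|c]]].
  - by apply: eq_card => i; rewrite inE /lab; case: (i \in A) => //; case: (i \in C).
  - apply: eq_card => i; rewrite inE /lab; case iA: (i \in A); first by rewrite AC.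
    by case: (i \in C).
  - have := cardsC (A :|: C); rewrite cardsU; move: (dAC); rewrite -setI_eq0 => /eqP->.
    rewrite cards0 subn0 card_ord => e.
    transitivity #|~: (A :|: C)|; last by lia.
    apply: eq_card => i; by rewrite !inE /lab; case: (i \in A) => //; case: (i \in C).
  - apply/eqP; rewrite cards_eq0; apply/eqP/setP => i; rewrite !inE /lab.
    by case: (i \in A) => //; case: (i \in C).
move=> d1 d2 cS cB; have [c|s hs] := @perm_of_labels (lab S B) (lab S' B').
  by rewrite !cl // cS cB.
exists s => i; have := hs i; rewrite /lab.
have F1 := disjointFr d1 (x := i); have F2 := disjointFr d2 (x := s i).
case iS: (i \in S); case sS: (s i \in S') => //.
- by rewrite F1 ?F2.
- by case: (s i \in B').
- by case: (i \in B).
- by case: (i \in B); case: (s i \in B').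
Qed.

Variables (h k : nat).
Hypothesis hn : n = (h * 2 + k)%N.

Lemma saturated_iso S (f : 'I_n -> {set 'I_n}) : (0 < k)%N -> (#|S| <= h)%N ->
  #|f @: ~: S| = (#|S| + k)%N ->
  (forall j, j \notin S ->
    class_size S f j = 1 \/ class_size S f j = ((h - #|S|) * 2).+1)%N ->
  graph_iso (saturated S f) (graph_H1 n #|S| k).
Proof.
move=> k0 sh q sz; set s := #|S|.
have cC : #|~: S| = (n - s)%N by rewrite cardsCs finset.setCK card_ord.
have sn : (s < n)%N by lia.
(* If all classes were singletons, then [n - s = s + k], hence [s = h], and a singleton already has
   the required size. *)
have [i [iS ci]] : exists i, i \notin S /\ class_size S f i = ((h - s) * 2).+1.
  apply: contrapT => none.
  have one j : j \notin S -> class_size S f j = 1%N.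
    by move=> jS; case: (sz j jS) => // e; case: none; exists j.
  have inj : {in ~: S &, injective f}.
    move=> i j iS jS e; have jS' : j \notin S by rewrite inE in jS.
    move/eqP: (one j jS') => /cards1P[z /setP ez].
    have := ez i; have := ez j; rewrite !inE in iS jS *.
    by rewrite iS jS e eqxx /= => /esym/eqP -> /esym/eqP ->.
  have := card_in_imset inj; rewrite q cC => e.
  have /card_gt0P[i] : (0 < #|~: S|)%N by lia.
  by rewrite inE => iS; apply: none; exists i; rewrite one //; split=> //; lia.
pose B := [set j in ~: S | f j == f i].
have cB : #|B| = ((h - s) * 2).+1 by [].
have BS : B \subset ~: S by apply/fintype.subsetP => j; rewrite inE => /andP[].
(* Outside [S] and the big class [B] there remain [s + k - 1] vertices and as many colours, so all
   other classes are singletons. *)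
have inj : {in ~: S :\: B &, injective f}.
  apply/imset_injP; have -> : f @: (~: S :\: B) = (f @: ~: S) :\ f i.
    apply/setP => c; rewrite !inE; apply/imsetP/andP.
      case=> j; rewrite !inE => /andP[jB jS] ->; rewrite jS /= in jB.
      by split=> //; apply: imset_f; rewrite inE.
    case=> nc /imsetP[j jS ec]; exists j => //.
    by rewrite !inE in jS *; rewrite jS /= andbT -ec.
  rewrite [#|~: S :\: B|]cardsD (finset.setIidPr BS) cC cB.
  have := cardsD1 (f i) (f @: ~: S); rewrite imset_f ?inE // q.
  by rewrite -/s => e; apply/eqP; lia.
have satE x y : saturated S f x y =
    (x != y) && [|| x \in S, y \in S | (x \in B) && (y \in B)].
  rewrite /saturated; case: eqVneq => //= nxy.
  case xS: (x \in S) => //=; case yS: (y \in S) => //=.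
  rewrite !inE xS yS /=; apply/eqP/andP => [e|[/eqP-> /eqP->]//].
  have [xB|xB] := boolP (f x == f i); first by rewrite -e xB.
  case/eqP: nxy; apply: inj => //; first by rewrite !inE xS xB.
  by rewrite !inE yS -e xB.
have sn' : (s + ((h - s) * 2).+1 <= n)%N by lia.
pose S' : {set 'I_n} := [set j : 'I_n | (j < s)%N].
pose B' : {set 'I_n} := [set j : 'I_n | (j < s + ((h - s) * 2).+1)%N] :\: S'.
have sub : S' \subset [set j : 'I_n | (j < s + ((h - s) * 2).+1)%N].
  by apply/fintype.subsetP => j; rewrite !inE; lia.
have [||||sg hsg] := @perm_two_sets S B S' B'.
- by rewrite finset.disjoints_subset -finset.setCS finset.setCK.
- by rewrite disjoint_sym finset.disjoints_subset finset.subsetDr.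
- by rewrite card_ord_lt //; lia.
- by rewrite cardsD (finset.setIidPr sub) !card_ord_lt //; lia.
exists sg => x y; rewrite satE /graph_H1 (inj_eq perm_inj).
have [x1 x2] := hsg x; have [y1 y2] := hsg y.
rewrite -x1 -x2 -y1 -y2 !inE; congr (_ && _).
by apply/idP/idP; lia.
Qed.

Section H1.

Variable s : nat.
Hypotheses (k0 : (0 < k)%N) (sh : (s <= h)%N).

Definition H1_core : {set 'I_n} := [set i : 'I_n | (i < s)%N].
(** Outside the core, the empty set is the common colour of the clique, and each independent vertex
    is coloured by its own singleton. *)
Definition H1_colour (i : 'I_n) : {set 'I_n} :=
  if (i < n + 1 - s - k)%N then finset.set0 else [set i].

Lemma card_H1_core : #|H1_core| = s.
Proof. by rewrite card_ord_lt //; lia. Qed.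

Lemma graph_H1_saturated : graph_H1 n s k =2 saturated H1_core H1_colour.
Proof.
move=> x y; rewrite /graph_H1 /saturated !inE /H1_colour; case: eqVneq => //= nxy.
congr [|| _, _ | _]; case: ifP => _; case: ifP => _ //=; rewrite ?eqxx //.
- by apply/esym/eqP => /setP/(_ y); rewrite !inE eqxx.
- by apply/esym/eqP => /setP/(_ x); rewrite !inE eqxx.
- by apply/esym/negbTE; rewrite (inj_eq set1_inj).
Qed.

Lemma H1_class_size j : j \notin H1_core ->
  (class_size H1_core H1_colour j = 1 \/
   class_size H1_core H1_colour j = ((h - s) * 2).+1)%N.
Proof.
rewrite inE -leqNgt => sj; rewrite /class_size /H1_colour.
have [jb|jb] := ltnP j (n + 1 - s - k); [right|left].
  have sub : H1_core \subset [set i : 'I_n | (i < n + 1 - s - k)%N].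
    by apply/fintype.subsetP => i; rewrite !inE; lia.
  transitivity #|[set i : 'I_n | (i < n + 1 - s - k)%N] :\: H1_core|; last first.
    by rewrite cardsD (finset.setIidPr sub) card_H1_core card_ord_lt; lia.
  apply: eq_card => i; rewrite !inE; congr andb; case: ifP => _; first by rewrite eqxx.
  by apply/eqP => /setP/(_ i); rewrite !inE eqxx.
transitivity #|[set j]|; last exact: cards1.
apply: eq_card => i; rewrite !inE -leqNgt.
case: (eqVneq i j) => [->|ij]; first by rewrite sj ltnNge jb /= eqxx.
case: ifP => _; last by rewrite (inj_eq set1_inj) (negPf ij) andbF.
by apply/negbTE/nandP; right; apply/eqP => /setP/(_ j); rewrite !inE eqxx.
Qed.

Lemma H1_card_colours : #|H1_colour @: ~: H1_core| = (s + k)%N.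
Proof.
pose Bc : {set 'I_n} := [set i : 'I_n | (n + 1 - s - k <= i)%N].
have sn : (s < n)%N by lia.
have -> : (H1_colour @: ~: H1_core) = ([set finset.set0] :|: [set [set i] | i in Bc]).
  apply/setP => c; rewrite !inE; apply/imsetP/orP.
    case=> i _ ->; rewrite /H1_colour; case: ltnP => ib; [by left|right].
    by apply: imset_f; rewrite inE.
  case=> [/eqP->|/imsetP[i ib ->]].
    exists (Ordinal sn); rewrite ?inE /= ?ltnn // /H1_colour /=.
    by rewrite (_ : (s < _)%N) //; lia.
  exists i; rewrite !inE in ib *; first by lia.
  by rewrite /H1_colour ltnNge ib.
rewrite cardsU1 card_imset; last exact: set1_inj.
rewrite (_ : finset.set0 \notin _); last first.
  by apply/imsetP => -[i _ /setP/(_ i)]; rewrite !inE eqxx.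
have -> : Bc = ~: [set i : 'I_n | (i < n + 1 - s - k)%N].
  by apply/setP => i; rewrite !inE -leqNgt.
by rewrite cardsCs finset.setCK card_ord card_ord_lt; lia.
Qed.

(** This graph is saturated, with [s + k] classes of the two extreme sizes. At a root of the cubic
    the test vector is therefore a positive eigenvector, and such an eigenvector belongs to the
    largest eigenvalue. *)
Lemma rho_H1 (R : realType) (a x : R) : (0 < s)%N -> 0 <= a -> a < 1 ->
  a * s%:R + 2 * (h%:R - s%:R) < x -> charcubic h%:R k%:R a s%:R x = 0 ->
  rho_alpha (graph_H1 n s k) a = x.
Proof.
move=> s0 a0 a1 xd f0.
have -> : graph_H1 n s k = saturated H1_core H1_colour.
  by apply/funext => i; apply/funext => j; exact: graph_H1_saturated.
have a01 : 0 <= a <= 1 by rewrite a0 ltW.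
have gs := saturated_sym H1_core H1_colour.
have cs := card_H1_core; have cq := H1_card_colours.
have e : forall i, aop (saturated H1_core H1_colour) a
    (class_weight H1_core H1_colour a x) i = x * class_weight H1_core H1_colour a x i.
  apply: (class_weight_eigenvector hn); rewrite ?cs ?cq //.
  exact: H1_class_size.
have w0 : forall i, 0 < class_weight H1_core H1_colour a x i.
  by move=> i; apply: (class_weight_gt0 hn); rewrite ?cs ?cq.
apply: (rho_alpha_eigenvalue gs a01 w0) => [i|]; first by rewrite e.
apply/(eigenvalue_aopP _ _ gs); exists (class_weight H1_core H1_colour a x); split=> //.
have n0 : (0 < n)%N by lia.
by exists (Ordinal n0); rewrite gt_eqF.
Qed.

End H1.

(** The size of the Tutte-Berge set is known only to lie between [t] and [h], so [x] must satisfy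
    the cubic inequality for every such [s]. *)
Lemma rho_alpha_bound (R : realType) (g : rel 'I_n) (t : nat) (a x : R) :
  (2 <= k)%N -> (0 < t)%N -> 0 <= a -> a < 1 ->
  simple_graph g -> t_connected g t -> (matching_number g <= h)%N ->
  (forall s, (t <= s <= h)%N ->
    a * s%:R + 2 * (h%:R - s%:R) < x /\ 0 <= charcubic h%:R k%:R a s%:R x) ->
  rho_alpha g a <= x /\
  (rho_alpha g a = x -> exists s, [/\ (t <= s <= h)%N,
     charcubic h%:R k%:R a s%:R x = 0 & graph_iso g (graph_H1 n s k)]).
Proof.
move=> k2 t0 a0 a1 [gs gi] tc mu H.
have [|S [f [fE SF]]] := tutte_berge gs gi (N := h).
  move=> m /covered_le_matching_number mm; apply: leq_trans mm _.
  by rewrite leq_pmul2r.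
rewrite card_ord in SF.
have qk : (#|S| + k <= #|f @: ~: S|)%N by lia.
(* At least [k >= 2] colours occur outside [S], so [S] is a cut. *)
have tS : (t <= #|S|)%N.
  by apply: connectivity_le_cut tc _; apply: is_cut_colouring fE _;
     exact: leq_trans k2 (leq_trans (leq_addl _ _) qk).
have sh : (#|S| <= h)%N.
  have qle : (#|f @: ~: S| <= #|~: S|)%N by exact: leq_imset_card.
  have cn := cardsC S; rewrite card_ord in cn.
  by move: (leq_trans qk qle) cn hn => le cn hn'; lia.
have s0 : (0 < #|S|)%N by lia.
have [xd f0] : _ /\ _ := H #|S| ltac:(by rewrite tS sh).
have sub : subrel g (saturated S f).
  move=> i j gij; rewrite /saturated.
  have -> /= : i != j by apply: contraTneq gij => ->; rewrite gi.
  case iS: (i \in S) => //=; case jS: (j \in S) => //=.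
  by apply/eqP/fE; rewrite ?iS ?jS.
have a01 : 0 <= a <= 1 by rewrite a0 ltW.
pose w := class_weight S f a x.
have w0 i : 0 < w i by apply: (class_weight_gt0 hn).
have sup := class_weight_supersolution hn s0 sh qk a0 a1 xd f0.
have mono i := aop_mono a0 a1 w0 sub i.
have gw i : aop g a w i <= x * w i := le_trans (mono i) (sup i).
have x0 : 0 < x.
  apply: le_lt_trans xd; rewrite addr_ge0 ?mulr_ge0 ?ler0n //.
  by rewrite subr_ge0 ler_nat.
split; first exact: (rho_alpha_le gs a01 w0 gw (ltW x0)).
move=> rx; have ev : eigenvalue (A_alpha g a) x.
  by rewrite -rx; apply: eigenvalue_rho; rewrite rx gt_eqF.
have eq i := eigenvalue_supersolution_eq gs a01 w0 gw gi a1
  (connected_of_t_connected t0 tc) ev i.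
(* The saturated graph is squeezed between [g], where equality holds, and the bound [x * w i];
   equality on both sides forces [g] to be saturated. *)
have es i : aop (saturated S f) a w i = x * w i.
  by apply/le_anti; rewrite sup -eq mono.
have [c0 q sz] := class_weight_eigenvectorP hn s0 sh qk a0 a1 xd f0 es.
exists #|S|; rewrite tS sh; split=> //.
have gE : g =2 saturated S f.
  by move=> i j; apply: (aop_mono_eq a0 a1 w0 sub); rewrite eq es.
have [|p hp] := saturated_iso _ sh q sz; first by lia.
by exists p => i j; rewrite gE hp.
Qed.

End Graph.

(** * Sign analysis of the cubics *)

Lemma half_products_ge0 (R : realType) (c m p z1 z2 z3 : R) : 0 <= z2 -> 0 <= z3 ->
  2 * (c * m) <= z1 * z2 -> 2 * (c * p) <= z1 * z3 ->
  0 <= z1 * z2 * z3 - c * (m * z3 + p * z2).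
Proof.
move=> z20 z30 h2 h3.
have -> : z1 * z2 * z3 - c * (m * z3 + p * z2) =
    ((z1 * z2 - 2 * (c * m)) * z3 + (z1 * z3 - 2 * (c * p)) * z2) / 2 by field.
by rewrite divr_ge0 // addr_ge0 // mulr_ge0 // subr_ge0.
Qed.

Section Cubic.

Variables (R : realType) (H K a : R).
Hypothesis adm : [/\ 1 <= H, 2 <= K, 0 <= a & 2 * a <= 1].

Let b : R := 1 - a.
(** [y1] and [y3] are the factors [x - d1] and [x - d3] of [charcubic] at [s = H], where
    [d2 = d3]. *)
Let y1 (x : R) := x - (a * (2 * H + K) - 1 + b * H).
Let y3 (x : R) := x - a * H.

(** The quotient [Q_s = (f_s - f_H) / (H - s)], arranged by powers of [H - s]. *)
Definition cubic_slope (s x : R) : R :=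
  b * y3 x ^+ 2 - 2 * b * y1 x * y3 x + b ^+ 2 * (H + K) * y3 x
  - b ^+ 2 * H * (y3 x + a - (1 + b) * (H + K - 1))
  + (H - s) * (b ^+ 2 * (a - y3 x - (1 + b) * (H + K - 1)) - a * (1 + b) * y1 x
     - b ^+ 2 * H * (a + 2))
  + (H - s) ^+ 2 * (b * (2 - 3 * a)).

Lemma charcubic_slope s x :
  charcubic H K a s x = charcubic H K a H x + (H - s) * cubic_slope s x.
Proof. by rewrite /charcubic /cubic_slope /y1 /y3 /b; ring. Qed.

Lemma charcubic_last x :
  charcubic H K a H x = y3 x * (y1 x * y3 x - b ^+ 2 * H * (H + K)).
Proof. by rewrite /charcubic /y1 /y3 /b; ring. Qed.

Lemma cubic_slope_lt t s x : 1 <= t -> t < s -> s <= H -> 0 <= y1 x -> 0 < y3 x ->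
  cubic_slope t x < cubic_slope s x.
Proof.
have [H1 K2 a0 a2] := adm.
move=> t1 ts sH y1_ge0 y3_gt0; rewrite -subr_gt0.
have -> : cubic_slope s x - cubic_slope t x = (s - t) *
    (b * (b * (y3 x + (1 + b) * (K - 1) - a + H * (a + 2) + (1 + b) * H)
          - (2 - 3 * a) * (H - s + (H - t))) + a * (1 + b) * y1 x).
  by rewrite /cubic_slope; ring.
move: (y1 x) (y3 x) y1_ge0 y3_gt0 => u w u0 w0.
rewrite mulr_gt0 ?subr_gt0 // ltr_wpDr ?mulr_ge0 ?mulr_gt0 //; rewrite /b; try lra.
have p1 : 0 < (1 - a) * w by rewrite mulr_gt0 //; lra.
have p2 : 0 <= (1 - a) * ((1 + (1 - a)) * (K - 1) - a).
  have : 0 <= (1 + (1 - a)) * (K - 2) by rewrite mulr_ge0; lra.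
  by move=> h; rewrite mulr_ge0; lra.
(* The multiples of [H] in the inner sum add up to [4 H], and [4 (1 - a) H] exceeds this bound
   [(4 - 6 a) H] by [2 a H]. *)
have p3 : (2 - 3 * a) * (H - s + (H - t)) <= (2 - 3 * a) * (2 * H).
  by rewrite ler_wpM2l; lra.
have p4 : 0 <= a * H by rewrite mulr_ge0; lra.
by nra.
Qed.

(** The radicand of [Delta1] with [n = 2H + K]; it is four times the discriminant of the quadratic
    factor of [f_H]. *)
Definition theta_radicand : R :=
  (2 * H - 2 + 2 * a * (2 * H + K)) ^+ 2 + 4 * ((2 * H + K) ^+ 2 - K ^+ 2)
  - 4 * a * (3 * (2 * H + K) + K - 2) * (2 * H).

(** The larger root of [y1 y3 = b^2 H (H + K)]. *)
Definition theta : R := (a * (2 * H + K) - 1 + H) / 2 + Num.sqrt theta_radicand / 4.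

Lemma theta_radicandE : theta_radicand =
  4 * ((a * (2 * H + K) - 1 + b * H - a * H) ^+ 2 + 4 * (b ^+ 2 * H * (H + K))).
Proof. by rewrite /theta_radicand /b; ring. Qed.

Let bHK_gt0 : 0 < b ^+ 2 * H * (H + K).
Proof.
have [H1 K2 a0 a2] := adm.
by rewrite /b !mulr_gt0 ?exprn_gt0; lra.
Qed.

Lemma theta_radicand_ge0 : 0 <= theta_radicand.
Proof.
have := ltW bHK_gt0; rewrite theta_radicandE => h.
by rewrite mulr_ge0 // addr_ge0 ?sqr_ge0 // mulr_ge0.
Qed.

Lemma theta_prod : y1 theta * y3 theta = b ^+ 2 * H * (H + K).
Proof.
have e := sqr_sqrtr theta_radicand_ge0; rewrite /y1 /y3 /theta.
move: (Num.sqrt _) e => r e.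
have -> : b ^+ 2 * H * (H + K) = (theta_radicand / 4
    - (a * (2 * H + K) - 1 + b * H - a * H) ^+ 2) / 4.
  by rewrite theta_radicandE; field.
by rewrite -e /b; field.
Qed.

Let y13_gt0 : 0 < y1 theta /\ 0 < y3 theta.
Proof.
have p := theta_prod; have s : 0 <= y1 theta + y3 theta.
  have -> : y1 theta + y3 theta = Num.sqrt theta_radicand / 2.
    by rewrite /y1 /y3 /theta /b; field.
  by rewrite divr_ge0 ?sqrtr_ge0.
have := bHK_gt0; rewrite -p; move: (y1 _) (y3 _) s => u w s uw.
have [u0|u0] := ltP 0 u; first by rewrite pmulr_rgt0 in uw.
have w0 : 0 <= w by lra.
by have := mulr_le0_ge0 u0 w0; lra.
Qed.

Lemma charcubic_theta : charcubic H K a H theta = 0.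
Proof. by rewrite charcubic_last theta_prod subrr mulr0. Qed.

(** If [theta <= d2], then [z2 <= 0] while [z1 z3 >= b^2 H (H + K) >= b^2 s (s + K - 1)], which
    makes the cubic negative. *)
Lemma theta_gt s : 1 <= s -> s <= H -> 0 <= charcubic H K a s theta ->
  a * s + 2 * (H - s) < theta.
Proof.
have [H1 K2 a0 a2] := adm.
move=> s1 sH; rewrite ltNge; apply: contraL => le; rewrite -ltNge.
have [u0 w0] := y13_gt0; have p := theta_prod.
have b0 : 0 < b by rewrite /b; lra.
have as_le : a * s <= a * H by rewrite ler_wpM2l.
have bs_le : b * s <= b * H by rewrite ler_wpM2l // ltW.
rewrite /charcubic -/b.
set z1 := theta - (_ + b * s); set z2 := theta - (a * s + _); set z3 := theta - a * s.
have hz1 : y1 theta <= z1 by rewrite /y1 /z1; lra.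
have hz3 : y3 theta <= z3 by rewrite /y3 /z3; lra.
have hz2 : z2 <= 0 by rewrite /z2; lra.
have big : b ^+ 2 * s * (s + K - 1) <= z1 * z3.
  apply: le_trans (_ : y1 theta * y3 theta <= _); last by rewrite ler_pM // ltW.
  by rewrite p -[leLHS]mulrA -[leRHS]mulrA ler_wpM2l ?sqr_ge0 // ler_pM; lra.
have -> : z1 * z2 * z3 - b ^+ 2 * s * ((2 * (H - s) + 1) * z3 + (s + K - 1) * z2) =
  z2 * (z1 * z3 - b ^+ 2 * s * (s + K - 1)) - b ^+ 2 * s * (2 * (H - s) + 1) * z3.
  by ring.
have t1 : z2 * (z1 * z3 - b ^+ 2 * s * (s + K - 1)) <= 0.
  by rewrite mulr_le0_ge0 // subr_ge0.
have t2 : 0 < b ^+ 2 * s * (2 * (H - s) + 1) * z3.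
  by rewrite !mulr_gt0 ?exprn_gt0 //; lra.
by lra.
Qed.

Lemma d2_le t s : t <= s -> a * s + 2 * (H - s) <= a * t + 2 * (H - t).
Proof.
have [H1 K2 a0 a2] := adm.
move=> ts; have : 0 <= (2 - a) * (s - t) by rewrite mulr_ge0; lra.
by lra.
Qed.

(** Since [f_H(theta) = 0], [f_s(theta) = (H - s) Q_s(theta)], and [Q_s(theta)] increases strictly
    with [s]. *)
Lemma charcubic_theta_ge0 t s : 1 <= t -> t <= s -> s <= H ->
  0 <= cubic_slope t theta ->
  [/\ a * s + 2 * (H - s) < theta, 0 <= charcubic H K a s theta &
    charcubic H K a s theta = 0 -> s = H \/ s = t /\ cubic_slope t theta = 0].
Proof.
have [H1 K2 a0 a2] := adm.
move=> t1 ts sH q; have [u0 w0] := y13_gt0.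
have fE r : charcubic H K a r theta = (H - r) * cubic_slope r theta.
  by rewrite charcubic_slope charcubic_theta add0r.
split.
- apply: le_lt_trans (d2_le ts) _; apply: theta_gt; rewrite ?fE //; first lra.
  by rewrite mulr_ge0 //; lra.
- rewrite fE mulr_ge0 ?subr_ge0 //; move: ts; rewrite le_eqVlt => /orP[/eqP<-//|ts].
  by apply/ltW/(le_lt_trans q)/cubic_slope_lt => //; exact: ltW.
- move/eqP; rewrite fE mulf_eq0 subr_eq0 => /orP[/eqP->|/eqP q0]; first by left.
  right; move: ts; rewrite le_eqVlt => /orP[/eqP e|ts]; first by rewrite e.
  have := cubic_slope_lt t1 ts sH (ltW u0) w0.
  by rewrite q0; lra.
Qed.

Lemma charcubic_root t : 1 <= t -> t < H -> cubic_slope t theta < 0 ->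
  exists x, [/\ theta < x, a * t + 2 * (H - t) < x, charcubic H K a t x = 0 &
    forall s, t < s -> s <= H -> 0 < charcubic H K a s x].
Proof.
have [H1 K2 a0 a2] := adm.
move=> t1 tH q; have [u0 w0] := y13_gt0.
have b0 : 0 < b by rewrite /b; lra.
have b20 : 0 < b ^+ 2 * t by rewrite mulr_gt0 ?exprn_gt0 //; lra.
pose d2 := a * t + 2 * (H - t); pose z := Num.max theta d2.
(* At [theta] the value is [(H - t) Q_t(theta) < 0]; at [d2] the triple product vanishes and only
   the subtracted term survives. *)
have fz : charcubic H K a t z < 0.
  rewrite /z; case: (leP theta d2) => _; last first.
    by rewrite charcubic_slope charcubic_theta add0r nmulr_llt0 //; lra.
  have -> : charcubic H K a t d2 = - (b ^+ 2 * t * ((2 * (H - t) + 1) * (2 * (H - t)))).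
    by rewrite /charcubic /d2 /b; ring.
  by rewrite oppr_lt0 !mulr_gt0 ?exprn_gt0 //; lra.
have at_le : a * t <= a * H by rewrite ler_wpM2l // ltW.
have bt_le : b * t <= b * H by rewrite ler_wpM2l // ltW.
have zth : theta <= z by rewrite le_max lexx.
have zd2 : d2 <= z by rewrite le_max lexx orbT.
(* At [z + 1 + L] the first factor is at least [L] and the others at least 1, so half of the triple
   product pays for each subtracted term. *)
pose L := 2 * (b ^+ 2 * t * ((2 * (H - t) + 1) + (t + K - 1))).
have L0 : 0 <= L by rewrite /L mulr_ge0 ?mulr_ge0 ?(ltW b20) //; lra.
have fY : 0 <= charcubic H K a t (z + 1 + L).
  rewrite /charcubic -/b -/d2.
  set z1 := _ - (_ + b * t); set z2 := _ - d2; set z3 := _ - a * t.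
  have hz1 : L <= z1 by rewrite /z1; move: u0; rewrite /y1; lra.
  have hz2 : 1 <= z2 by rewrite /z2; lra.
  have hz3 : 1 <= z3 by rewrite /z3; move: w0; rewrite /y3; lra.
  have A1 : 2 * (b ^+ 2 * t * (2 * (H - t) + 1)) <= z1 * z2.
    apply: le_trans (_ : L * 1 <= _); last by rewrite ler_pM.
    by rewrite mulr1 /L ler_wpM2l // ler_wpM2l ?(ltW b20) //; lra.
  have A2 : 2 * (b ^+ 2 * t * (t + K - 1)) <= z1 * z3.
    apply: le_trans (_ : L * 1 <= _); last by rewrite ler_pM.
    by rewrite mulr1 /L ler_wpM2l // ler_wpM2l ?(ltW b20) //; lra.
  by apply: half_products_ge0 => //; lra.
pose P : {poly R} :=
  ('X - (a * (2 * H + K) - 1 + b * t)%:P) * ('X - d2%:P) * ('X - (a * t)%:P)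
  - (b ^+ 2 * t)%:P * ((2 * (H - t) + 1)%:P * ('X - (a * t)%:P)
                       + (t + K - 1)%:P * ('X - d2%:P)).
have PE x : P.[x] = charcubic H K a t x.
  by rewrite /P !hornerE.
have [||x /andP[zx _] /rootP] := @poly_ivt _ P z (z + 1 + L).
- by lra.
- by rewrite !PE (ltW fz).
rewrite PE => fx; have {zx} zx : z < x.
  by rewrite lt_neqAle zx andbT; apply: contraTneq fz => ->; rewrite fx ltxx.
have thx : theta < x by lra.
have ux : y1 theta < y1 x by rewrite /y1; lra.
have wx : y3 theta < y3 x by rewrite /y3; lra.
have F0 : 0 < charcubic H K a H x.
  rewrite charcubic_last mulr_gt0 //; first lra.
  by rewrite subr_gt0 -theta_prod ltr_pM // ltW.
exists x; split=> //; first by rewrite -/d2; lra.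
move=> s ts sH; move: fx; rewrite charcubic_slope => fx.
have qs : cubic_slope t x < cubic_slope s x.
  by apply: cubic_slope_lt => //; lra.
rewrite charcubic_slope.
have qt : cubic_slope t x < 0.
  rewrite -(pmulr_rlt0 (x := H - t)); lra.
(* As [f_t(x) = 0], [f_s(x) = (H - s)(Q_s - Q_t) - (s - t) Q_t], where [Q_t < 0] because
   [f_H(x) > 0]. *)
have C1 : 0 <= (H - s) * (cubic_slope s x - cubic_slope t x).
  by rewrite mulr_ge0; lra.
have C2 : 0 < (s - t) * - cubic_slope t x by rewrite mulr_gt0; lra.
by lra.
Qed.

End Cubic.

(* The difference of the two sides is a multiple of r^2 - theta_radicand, where
   r is the square root occurring in theta. *)
Lemma Delta1_slope (R : realType) (n h k t : nat) (a : R) : n = (h * 2 + k)%N ->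
  (0 < h)%N -> (2 <= k)%N -> 0 <= a -> 2 * a <= 1 ->
  Delta1 n t k a =
  4 * cubic_slope h%:R k%:R a t%:R (theta h%:R k%:R a).
Proof.
move=> hn h0 k2 a0 a2.
have nR : n%:R = 2 * h%:R + k%:R :> R by rewrite hn natrD natrM; ring.
have adm : [/\ (1 : R) <= h%:R, (2 : R) <= k%:R, 0 <= a & 2 * a <= 1].
  by split; rewrite ?ler1n // -[2]/(2%:R) ler_nat.
have e := sqr_sqrtr (theta_radicand_ge0 adm).
rewrite /Delta1 nR; set D := (X in Num.sqrt X).
have -> : D = theta_radicand h%:R k%:R a by rewrite /D /theta_radicand; ring.
rewrite /theta; move: (Num.sqrt _) e => r e.
transitivity (4 * cubic_slope h%:R k%:R a t%:R ((a * (2 * h%:R + k%:R) - 1 + h%:R) / 2 + r / 4)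
  + (1 - a) / 4 * (r ^+ 2 - theta_radicand h%:R k%:R a)); last first.
  by rewrite e subrr mulr0 addr0.
by rewrite /cubic_slope /theta_radicand; field.
Qed.

(** * The extremal graphs and the three cases *)

Lemma graph_H1_sym n t k : symmetric (graph_H1 n t k).
Proof.
by move=> x y; rewrite /graph_H1 eq_sym orbCA [X in [|| _, _ | X]]andbC.
Qed.

(** For [s = h] the middle clique is a single vertex and joins the independent set. *)
Lemma graph_H1_H2 (n h k : nat) : n = (h * 2 + k)%N -> graph_H1 n h k = graph_H2 n k.
Proof.
move=> hn; apply/funext => x; apply/funext => y.
rewrite /graph_H1 /graph_H2; case: eqVneq => //= nxy.
have nv : (x : nat) != y by [].
have -> : (n - k)./2 = h by rewrite hn addnK muln2 doubleK.
by move: nv => /eqP nv; apply/idP/idP; lia.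
Qed.

Theorem theorem3p4 (R : realType) (n t k : nat) (alpha : R) (g : rel 'I_n) :
  (2 <= k)%N -> (k <= n - 2)%N -> (1 <= t)%N -> (t <= (n - k)./2)%N ->
  (n %% 2 = k %% 2)%N ->
  0 <= alpha -> alpha <= 2^-1 ->
  simple_graph g -> t_connected g t ->
  (matching_number g <= (n - k)./2)%N ->
  [/\ Delta1 n t k alpha < 0 ->
        rho_alpha g alpha <= rho_alpha (graph_H1 n t k) alpha /\
        (rho_alpha g alpha = rho_alpha (graph_H1 n t k) alpha <-> graph_iso g (graph_H1 n t k)),
      Delta1 n t k alpha = 0 -> 0 <= Delta2 n t k alpha ->
        [/\ rho_alpha g alpha <= rho_alpha (graph_H1 n t k) alpha,
            rho_alpha (graph_H1 n t k) alpha = rho_alpha (graph_H2 n k) alpha &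
            (rho_alpha g alpha = rho_alpha (graph_H1 n t k) alpha <->
               graph_iso g (graph_H1 n t k) \/ graph_iso g (graph_H2 n k))]
    & 0 < Delta1 n t k alpha -> 0 <= Delta2 n t k alpha ->
        rho_alpha g alpha <= rho_alpha (graph_H2 n k) alpha /\
        (rho_alpha g alpha = rho_alpha (graph_H2 n k) alpha <-> graph_iso g (graph_H2 n k))].
Proof.
set h := (n - k)./2 => k2 kn t1 th mod2 a0 a2 sg tc mu.
have hn : n = (h * 2 + k)%N by rewrite /h; lia.
have h0 : (0 < h)%N by lia.
have k0 : (0 < k)%N by lia.
have aa : 2 * alpha <= 1 by lra.
have a1 : alpha < 1 by lra.
have adm : [/\ (1 : R) <= h%:R, (2 : R) <= k%:R, 0 <= alpha & 2 * alpha <= 1].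
  by split; rewrite ?ler1n // -[2]/(2%:R) ler_nat.
have t1R : 1 <= t%:R :> R by rewrite ler1n.
rewrite (Delta1_slope t hn h0 k2 a0 aa) -(graph_H1_H2 hn).
set th0 := theta _ _ _; set q := cubic_slope _ _ _ _ _.
have bound x := rho_alpha_bound hn (x := x) k2 t1 a0 a1 sg tc mu.
have gs : symmetric g by case: sg.
have iso_rho s : graph_iso g (graph_H1 n s k) ->
    rho_alpha g alpha = rho_alpha (graph_H1 n s k) alpha.
  exact/graph_iso_rho/graph_H1_sym.
have last_gt : alpha * h%:R + 2 * (h%:R - h%:R) < th0.
  by apply: (theta_gt adm) => //; rewrite ?ler1n ?(charcubic_theta adm).
have rho_last : rho_alpha (graph_H1 n h k) alpha = th0.
  by apply: (rho_H1 hn) => //; exact: charcubic_theta.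
have ge_case : 0 <= q -> forall s, (t <= s <= h)%N ->
    [/\ alpha * s%:R + 2 * (h%:R - s%:R) < th0,
        0 <= charcubic h%:R k%:R alpha s%:R th0 &
        charcubic h%:R k%:R alpha s%:R th0 = 0 -> s = h \/ s = t /\ q = 0].
  move=> q0 s /andP[ts sh].
  have [] := charcubic_theta_ge0 adm t1R (s := s%:R) _ _ q0; rewrite ?ler_nat //.
  move=> d f c; split=> // /c[/eqP|[/eqP e ?]]; first by rewrite eqr_nat => /eqP; left.
  by right; split=> //; move: e; rewrite eqr_nat => /eqP.
have lt_case : q < 0 -> exists x, rho_alpha (graph_H1 n t k) alpha = x /\
    forall s, (t <= s <= h)%N ->
    [/\ alpha * s%:R + 2 * (h%:R - s%:R) < x, 0 <= charcubic h%:R k%:R alpha s%:R x &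
        charcubic h%:R k%:R alpha s%:R x = 0 -> s = t].
  (* For [t = h] only [s = h] occurs and [theta] itself serves; otherwise [charcubic_root] supplies
     a root beyond [theta]. *)
  move=> q0; have [eth|neth] := eqVneq t h.
    exists th0; rewrite eth; split=> // s; rewrite -eqn_leq => /eqP <-.
    by split; rewrite ?(charcubic_theta adm).
  have tH : t%:R < h%:R :> R by rewrite ltr_nat ltn_neqAle neth.
  have [x [_ xd fx fs]] := charcubic_root adm t1R tH q0.
  exists x; split; first exact: (rho_H1 hn k0 th t1 a0 a1).
  move=> s /andP[]; rewrite leq_eqVlt => /orP[/eqP <- _|ts sh]; first by rewrite fx.
  have := fs s%:R; rewrite ltr_nat ler_nat => /(_ ts sh) f0.
  split; [|exact: ltW|by move=> e; rewrite e ltxx in f0].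
  by apply: le_lt_trans xd; apply: (d2_le adm); rewrite ler_nat ltnW.
split.
- rewrite pmulr_rlt0 // => /lt_case[x [ex H]].
  have [s ts|le eq] := bound x; first by have [? ? _] := H s ts.
  rewrite ex; split=> //; split=> [/eq[s [ts c iso]]|/iso_rho->//].
  by have [_ _ /(_ c) <-] := H s ts.
- move/eqP; rewrite mulf_eq0 pnatr_eq0 /= => /eqP q0 _.
  have /ge_case H : 0 <= q by rewrite q0.
  (* With [Q_t(theta) = 0] the cubics for [t] and [h] both vanish at [theta], so the two graphs
     share this spectral radius. *)
  have rho_t : rho_alpha (graph_H1 n t k) alpha = th0.
    have [|d _ _] := H t; first by rewrite leqnn.
    apply: (rho_H1 hn) => //; rewrite charcubic_slope (charcubic_theta adm) add0r.
    by rewrite -/q q0 mulr0.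
  have [s ts|le eq] := bound th0; first by have [? ? _] := H s ts.
  rewrite rho_t rho_last; split=> //; split=> [/eq[s [ts c iso]]|[]/iso_rho->//].
  by have [_ _ /(_ c)[<-|[<- _]]] := H s ts; [right|left].
- rewrite pmulr_rgt0 // => q0 _; have H := ge_case (ltW q0).
  have [s ts|le eq] := bound th0; first by have [? ? _] := H s ts.
  rewrite rho_last; split=> //; split=> [/eq[s [ts c iso]]|/iso_rho->//].
  by have [_ _ /(_ c)[<-//|[_ e]]] := H s ts; rewrite e ltxx in q0.
Qed.
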